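(* Let $k : \mathbb{R}^m \times \mathbb{R}^n \to \mathbb{R}^m$ be a twice continuously differentiable multivariate function of two variables $z^\star \in \mathbb{R}^m$ and $p \in \mathbb{R}^n$ such that $k$ defines a fixed point for $z^\star$, i.e. $k(z^\star, p) = 0$ for all values of $p \in \mathbb{R}^n$. Then the Hessian of the (implicitly defined) $z^\star$ with respect to $p$ is given by $$H_p z^\star = -\Big[ (D_{z^\star} k)^{-1} \otimes I \Big] \Big[ H_p k + (D_{p z^\star} k)(D_p z^\star) + \big(I \otimes (D_p z^\star)^T\big)(D_{z^\star p} k) + \big(I \otimes (D_p z^\star)^T\big)(H_{z^\star} k)(D_p z^\star) \Big].$$
   Context: The variable $z^\star$ is regarded as a function of $p$ defined implicitly by $k(z^\star,p)=0$; $D_p z^\star \in \mathbb{R}^{m\times n}$ is its Jacobian, and all derivatives of $k$ are evaluated at $(z^\star, p)$. For a vector function $g$, $D_x g \in \mathbb{R}^{\dim(g)\times\dim(x)}$ denotes its partial Jacobian matrix with respect to $x$. For $g : \mathbb{R}^{\dim(x)} \times \mathbb{R}^{\dim(y)} \to \mathbb{R}^{\dim(g)}$ with scalar components $g_1,\dots,g_{\dim(g)}$, the second-order mixed partial derivative is represented as the stacked matrix $$D_{xy} g = \begin{bmatrix} D_y(\nabla_x g_1) \\ \vdots \\ D_y(\nabla_x g_{\dim(g)}) \end{bmatrix} \in \mathbb{R}^{\dim(g)\dim(x) \times \dim(y)},$$ and $H_x g := D_{xx} g$, i.e. the Hessians of the components of $g$ with respect to $x$, stacked vertically. In particular $H_p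 z^\star \in \mathbb{R}^{mn\times n}$ is the vertical stack of the Hessians of the components of $z^\star$. The derivatives $D_{z^\star} k, D_{p z^\star}k, D_{z^\star p}k, H_{z^\star} k, H_p k$ are partial: the two arguments of $k$ are treated as independent. $\otimes$ is the Kronecker product and $I$ is an identity matrix: $n\times n$ in $(D_{z^\star}k)^{-1}\otimes I$, and $m\times m$ in $I\otimes (D_p z^\star)^T$. *)

(* Defs.v *)
(* [A *t B], from mxtens, is the Kronecker product. *)
From HB Require Import structures.
From mathcomp Require Import all_boot all_order all_algebra.
From mathcomp Require Import all_classical all_reals all_analysis.
From mathcomp Require Export mxtens.

Set Implicit Arguments.
Unset Strict Implicit.
Unset Printing Implicit Defensive.

Import Order.TTheory GRing.Theory Num.Theory.
Import numFieldNormedType.Exports.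

Local Open Scope classical_set_scope.
Local Open Scope ring_scope.

(* Points of R^n are row vectors, since this is what [jacobian] acts on.
   [jacobian] is the matrix of ['d g x] for right multiplication of rows, i.e.
   the transpose of the usual dim(g) x dim(x) Jacobian matrix. *)
Definition Dmx (R : realType) (n c : nat) (g : 'rV[R]_n -> 'rV[R]_c)
  (x : 'rV[R]_n) : 'M[R]_(c, n) := (jacobian g x)^T.

Definition grad (R : realType) (n : nat) (h : 'rV[R]_n -> R)
  (x : 'rV[R]_n) : 'rV[R]_n := \row_j 'D_(delta_mx 0 j) h x.

(* Row (i, a) is stored at index i * n + a, the convention of [*t]. *)
Definition vstack (R : realType) (c n b : nat) (B : 'I_c -> 'M[R]_(n, b)) :
  'M[R]_(c * n, b) :=
  \matrix_(r, j) B (mxtens_unindex r).1 (mxtens_unindex r).2 j.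

(* D_{xy} g at (x, y): the blocks are the matrices D_y (\nabla_x g_i). *)
Definition Dmixed (R : realType) (n b c : nat)
  (g : 'rV[R]_n -> 'rV[R]_b -> 'rV[R]_c) (x : 'rV[R]_n) (y : 'rV[R]_b) :
  'M[R]_(c * n, b) :=
  vstack (fun i : 'I_c =>
    Dmx (fun y' => grad (fun x' => g x' y' 0 i) x) y).

(* H_x g = D_{xx} g. *)
Definition Hmx (R : realType) (n c : nat) (g : 'rV[R]_n -> 'rV[R]_c)
  (x : 'rV[R]_n) : 'M[R]_(c * n, n) :=
  vstack (fun i : 'I_c => Dmx (grad (fun x' => g x' 0 i)) x).

(* Continuity of v-derivatives for every fixed v is the same as norm-continuity
   of x |-> 'd f x because the domain is finite-dimensional. *)
Definition C1 (R : realType) (a b c : nat)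
  (f : 'rV[R]_a * 'rV[R]_b -> 'rV[R]_c) : Prop :=
  (forall x, differentiable f x) /\ (forall v, continuous ('D_v f)).

Definition C2 (R : realType) (a b c : nat)
  (f : 'rV[R]_a * 'rV[R]_b -> 'rV[R]_c) : Prop :=
  C1 f /\ (forall v, C1 ('D_v f)).

(* Main.v *)
(* The expansion of k at (z(p), p), together with k(z(q), q) = 0, gives
   dz = - (D_z k)^-1 (D_p k) dq + o(|dz| + |dq|).  As z is continuous, the term
   o(|dz|) can be absorbed in the left-hand side, so z is differentiable at p.
   The unit condition is open along the graph of z, because
   q |-> det (D_z k)(z(q), q) is continuous at p; hence z is differentiable near
   p and Dz = - (D_z k)^-1 (D_p k) there, which is differentiable at p.
   Differentiating (D_z k) Dz + D_p k = 0 once more along the graph of z gives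
   the Hessian entrywise.  Symmetry of second derivatives is not involved: the
   order of differentiation is the same on both sides. *)
Require Import Defs.
From HB Require Import structures.
From mathcomp Require Import all_boot all_order all_algebra.
From mathcomp Require Import all_classical all_reals all_analysis.
From mathcomp Require Import mxtens.
From mathcomp Require Import lra.

Set Implicit Arguments.
Unset Strict Implicit.
Unset Printing Implicit Defensive.

Import Order.TTheory GRing.Theory Num.Theory.
Import numFieldNormedType.Exports.

Local Open Scope classical_set_scope.
Local Open Scope ring_scope.

(** * Differentiability of functions, of matrix inverses and of implicitly defined maps *)

Section Differentiability.
Variable R : realType.
Implicit Types V W X : normedModType R.

Lemma diff_near V W (f : V -> W) x e : differentiable f x -> 0 < e ->
  \forall y \near x, `|f y - f x - 'd f x (y - x)| <= e * `|y - x|.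
Proof.
move=> /diff_locallyP[_ /eqaddoP df] e0.
rewrite (near_shift 0 x).
have := df _ e0; apply: filter_app; near=> h.
by rewrite /= subr0 !fctE /= !addrK opprD addrA.
Unshelve. all: by end_near. Qed.

Lemma near_differentiable V W (f : V -> W) (L : {linear V -> W}) x :
  continuous L ->
  (forall e, 0 < e ->
     \forall y \near x, `|f y - f x - L (y - x)| <= e * `|y - x|) ->
  differentiable f x.
Proof.
move=> cL fL.
have fo : f \o shift x = cst (f x) + L +o_ 0 id.
  apply/eqaddoP => e e0.
  have := fL _ e0; rewrite (near_shift 0 x).
  apply: filter_app; near=> h.
  by rewrite /= subr0 !fctE /= !addrK opprD addrA.
(* [diff_locallyP] speaks of ['d f x] itself; [diff_unique] identifies it with the candidate [L]. *)
by apply/diff_locallyP; rewrite (diff_unique cL fo).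
Unshelve. all: by end_near. Qed.

(** Differentiability is local. This transfers it from explicit formulas that are valid only near
    the point. *)
Lemma near_eq_differentiable V W (f g : V -> W) x :
  (\forall y \near x, f y = g y) -> differentiable f x -> differentiable g x.
Proof.
move=> fg df; apply: (@near_differentiable _ _ _ ('d f x)) => [|e e0].
  exact: diff_continuous.
have := diff_near df e0; have fgx := nbhs_singleton fg.
apply: filterS2 fg => y fgy.
by rewrite fgy fgx.
Qed.

Lemma differentiable_mxP V m n (M : V -> 'M[R]_(m, n)) x :
  differentiable M x <-> forall i j, differentiable (fun y => M y i j) x.
Proof.
split=> [dM i j|dM].
  exact: (differentiable_comp dM (differentiable_coord _ i j)).
have -> : M = \sum_i \sum_j (fun y => M y i j *: delta_mx i j).
  apply/funext => y; rewrite [LHS]matrix_sum_delta fct_sumE.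
  by apply: eq_bigr => i _; rewrite fct_sumE.
apply: differentiable_sum => i; apply: differentiable_sum => j.
exact: differentiableZl.
Qed.

Lemma differentiable_prod V (I : Type) (r : seq I) (f : I -> V -> R) x :
  (forall i, differentiable (f i) x) ->
  differentiable (fun y => \prod_(i <- r) f i y) x.
Proof.
move=> df; elim: r => [|i r IH].
  by under eq_fun do rewrite big_nil; exact: differentiable_cst.
by under eq_fun do rewrite big_cons; exact: differentiableM.
Qed.

Lemma differentiable_sumr V W (I : Type) (r : seq I) (f : I -> V -> W) x :
  (forall i, differentiable (f i) x) ->
  differentiable (fun y => \sum_(i <- r) f i y) x.
Proof.
move=> df; elim: r => [|i r IH].
  by under eq_fun do rewrite big_nil; exact: differentiable_cst.
by under eq_fun do rewrite big_cons; exact: differentiableD.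
Qed.

Lemma differentiable_mulmx V m n r (A : V -> 'M[R]_(m, n))
    (B : V -> 'M[R]_(n, r)) x :
  differentiable A x -> differentiable B x ->
  differentiable (fun y => A y *m B y) x.
Proof.
move=> /differentiable_mxP dA /differentiable_mxP dB.
apply/differentiable_mxP => i j.
under eq_fun do rewrite mxE.
by apply: differentiable_sumr => l; exact: differentiableM.
Qed.

Lemma differentiable_det V n (A : V -> 'M[R]_n) x :
  differentiable A x -> differentiable (fun y => \det (A y)) x.
Proof.
(* The determinant unfolds to the Leibniz sum over permutations [s]. *)
move=> /differentiable_mxP dA; apply: differentiable_sumr => s.
apply: differentiableM; first exact: differentiable_cst.
exact: differentiable_prod.
Qed.

Lemma differentiable_adj V n (A : V -> 'M[R]_n) x :
  differentiable A x -> differentiable (fun y => \adj (A y)) x.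
Proof.
move=> /differentiable_mxP dA; apply/differentiable_mxP => i j.
under eq_fun do rewrite mxE.
apply: differentiableM; first exact: differentiable_cst.
apply: differentiable_det; apply/differentiable_mxP => k l.
by under eq_fun do rewrite !mxE.
Qed.

Lemma differentiable_invmx V n (A : V -> 'M[R]_n) x :
  differentiable A x -> A x \in unitmx ->
  (\forall y \near x, A y \in unitmx) /\
  differentiable (fun y => invmx (A y)) x.
Proof.
move=> dA Au; have dd := differentiable_det dA.
have nd : \forall y \near x, A y \in unitmx.
  have : \det (A x) != 0 by rewrite -unitfE -unitmxE.
  move/cvgr_neq0: (differentiable_continuous dd) => /[apply].
  by apply: filterS => y; rewrite unitmxE unitfE.
split=> //.
(* [invmx] is the adjugate formula on invertible matrices and the identity map elsewhere, so the
   formula is available only near [x]. *)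
apply: (@near_eq_differentiable _ _ (fun y => (\det (A y))^-1 *: \adj (A y))).
  by apply: filterS nd => y Ay; rewrite /invmx Ay.
apply/differentiable_mxP => i j; under eq_fun do rewrite mxE.
apply: differentiableM.
  by apply: differentiableV => //; rewrite -unitfE -unitmxE.
by have /differentiable_mxP := differentiable_adj dA; apply.
Qed.

(** Write [T] for ['d k (z p, p)]. The linearised constraint T (dz, dq) = 0 and the left inverse [L]
    of [u |-> T (u, 0)] give dz = - L (T (0, dq)). This is the candidate differential [S]; what
    remains is to estimate its remainder. *)
Lemma implicit_differentiable V W X (k : V * W -> X) (z : W -> V)
    (L : {linear X -> V}) p :
  differentiable k (z p, p) -> {for p, continuous z} ->
  (forall q, k (z q, q) = k (z p, p)) ->
  continuous L -> (forall u, L ('d k (z p, p) (u, 0)) = u) ->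
  differentiable z p.
Proof.
move=> dk cz kz cL.
set T := 'd k (z p, p) => LT.
have [C C0 LC] := linear_lipschitz cL.
have cT : continuous T := diff_continuous dk.
have [D D0 TD] := linear_lipschitz cT.
have pairD (h1 h2 : W) c : (0, c *: h1 + h2) = c *: (0, h1) + (0, h2) :> V * W.
  by apply: injective_projections; rewrite /= ?scaler0 ?addr0.
pose S h := - L (T (0, h)).
have S_linear : linear S.
  by move=> c h1 h2; rewrite /S pairD [T _]linearP linearP opprD scalerN.
pose SM := GRing.isLinear.Build _ _ _ _ _ S_linear.
pose SL : {linear W -> V} := HB.pack S SM.
have cS : continuous SL.
  move=> h; apply: cvgN; apply: (@continuous_comp _ _ _ (fun h => T (0, h)) L);
    last exact: cL.
  apply: (@continuous_comp _ _ _ (fun h => (0, h)) T); last exact: cT.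
  by apply: cvg_pair; [exact: cvg_cst|exact: cvg_id].
(* The remainder of the candidate is exactly [L] applied to [T] of the increment along the graph. *)
have dz q : z q - z p + L (T (0, q - p)) = L (T ((z q, q) - (z p, p))).
  rewrite -{1}[z q - z p]LT -!linearD; congr (L (T _)).
  by apply: injective_projections; rewrite /= ?addr0 ?add0r.
apply: (near_differentiable cS) => e e0.
pose K := C * D; have K0 : 0 < K by exact: mulr_gt0.
(* [c <= 1 / 2] absorbs [c * |dz|]: it gives [|dz| <= (2 * K + 1) * |dq|], and
   then [ce] bounds the remainder by [e * |dq|]. *)
pose c := Num.min (1 / 2) (e / (2 * K + 2)).
have c0 : 0 < c by rewrite lt_min !divr_gt0//; lra.
have c2 : c <= 1 / 2 by rewrite ge_min lexx.
have ce : c * (2 * K + 2) <= e.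
  by rewrite -ler_pdivlMr ?ge_min ?lexx ?orbT//; lra.
have cvgzp : (fun q => (z q, q)) @ p --> (z p, p).
  by apply: cvg_pair; [exact: cz|exact: cvg_id].
(* The tolerance is divided by the Lipschitz constant [C] of [L], so that [c] is left once [L] is
   applied. *)
move: (cvgzp _ (diff_near dk (divr_gt0 c0 C0))).
apply: (@filterS _ (nbhs p)) => q /=.
(* As [k] is constant along the graph, the expansion bounds [T] of the increment alone. *)
rewrite kz subrr sub0r normrN -/T => Tq.
rewrite /S opprK dz.
have rc : `|L (T ((z q, q) - (z p, p)))| <= c * (`|z q - z p| + `|q - p|).
  apply: (le_trans (LC _)); rewrite -ler_pdivlMl//.
  apply: (le_trans Tq); rewrite [c / C]mulrC -mulrA.
  rewrite ler_pM2l ?invr_gt0// ler_pM2l//.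
  by rewrite prod_normE ge_max /= lerDl lerDr !normr_ge0.
have LTK : `|L (T (0, q - p))| <= K * `|q - p|.
  apply: (le_trans (LC _)); rewrite /K -mulrA ler_pM2l//.
  apply: (le_trans (TD _)); rewrite ler_pM2l//.
  by rewrite prod_normE ge_max /= normr0 normr_ge0 lexx.
have dzK : `|z q - z p| <= `|L (T ((z q, q) - (z p, p)))| + K * `|q - p|.
  rewrite -dz; apply: (le_trans _ (lerD (lexx _) LTK)).
  by rewrite -{1}[z q - z p](addrK (L (T (0, q - p)))) ler_normB.
move: rc dzK (normr_ge0 (z q - z p)) (normr_ge0 (q - p)).
move: `|L _| `|z q - z p| `|q - p| => r a b rc dzK a0 b0.
have ab : a + b <= (2 * K + 2) * b by nra.
by apply: (le_trans rc); nra.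
Qed.

End Differentiability.

(** * Directional derivatives on a product space and entries of Jacobian matrices *)

Section DirectionalDerivatives.
Variable R : realType.
Implicit Types V W X : normedModType R.

(** The difference quotients on both sides are the same function of [h]. *)
Lemma derive_slicel V W X (f : V * W -> X) v x y :
  'D_v (fun x' => f (x', y)) x = 'D_(v, 0) f (x, y).
Proof.
suff E h : f (h *: (v, 0) + (x, y)) = f (h *: v + x, y).
  by rewrite /derive /=; under [in RHS]eq_fun do rewrite /= E.
by congr (f (_, _)); rewrite /= scaler0 add0r.
Qed.

Lemma derive_slicer V W X (f : V * W -> X) w x y :
  'D_w (fun y' => f (x, y')) y = 'D_(0, w) f (x, y).
Proof.
suff E h : f (h *: (0, w) + (x, y)) = f (x, h *: w + y).
  by rewrite /derive /=; under [in RHS]eq_fun do rewrite /= E.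
by congr (f (_, _)); rewrite /= scaler0 add0r.
Qed.

Lemma differentiable_slicel V W X (f : V * W -> X) x y :
  differentiable f (x, y) -> differentiable (fun x' => f (x', y)) x.
Proof.
by move=> df; apply: (@differentiable_comp _ _ _ _ (fun x' => (x', y)) f) => //.
Qed.

Lemma differentiable_slicer V W X (f : V * W -> X) x y :
  differentiable f (x, y) -> differentiable (fun y' => f (x, y')) y.
Proof.
by move=> df; apply: (@differentiable_comp _ _ _ _ (fun y' => (x, y')) f) => //.
Qed.

Lemma differentiable_graph V W X (f : V * W -> X) (z : W -> V) p :
  differentiable z p -> differentiable f (z p, p) ->
  differentiable (fun q => f (z q, q)) p.
Proof.
move=> dz df; apply: (@differentiable_comp _ _ _ _ (fun q => (z q, q)) f) => //.
by apply: differentiable_pair => //; exact: ex_diff.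
Qed.

Lemma derive_graph V W X (f : V * W -> X) (z : W -> V) p v :
  differentiable z p -> differentiable f (z p, p) ->
  'D_v (fun q => f (z q, q)) p = 'D_('D_v z p, v) f (z p, p).
Proof.
move=> dz df; have did : differentiable (@id W) p by exact: ex_diff.
have dg : differentiable (fun q => (z q, q)) p by exact: differentiable_pair.
rewrite !deriveE//; last exact: differentiable_graph.
rewrite (@diff_comp _ _ _ _ (fun q => (z q, q)) f)//= diff_pair//.
by rewrite (@diff_val _ _ _ _ _ _ _ (is_diff_id p)).
Qed.

Lemma derive_coord V m n (M : V -> 'M[R]_(m, n)) x v i j :
  differentiable M x -> 'D_v (fun y => M y i j) x = 'D_v M x i j.
Proof. by move=> dM; rewrite derive_mx ?mxE//; exact: diff_derivable. Qed.

(** Serves to differentiate one entry of (D_z k) Dz + D_p k along the graph: [F], [J] and [G] will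
    be entries of D_z k, Dz and D_p k. *)
Lemma derive_sum_mulD V n (F J : 'I_n -> V -> R) (G : V -> R) x v :
  (forall l, differentiable (F l) x) -> (forall l, differentiable (J l) x) ->
  differentiable G x ->
  'D_v (fun y => \sum_l F l y * J l y + G y) x =
  \sum_l (F l x * 'D_v (J l) x + J l x * 'D_v (F l) x) + 'D_v G x.
Proof.
move=> dF dJ dG.
have -> : (fun y => \sum_l F l y * J l y + G y) = \sum_l (F l * J l) + G.
  by apply/funext => y; rewrite fctE fct_sumE.
have dFJ l : differentiable (F l * J l) x by exact: differentiableM.
have dS : differentiable (\sum_l (F l * J l)) x by exact: differentiable_sum.
rewrite (deriveD (diff_derivable dS) (diff_derivable dG)).
congr (_ + _); rewrite derive_sum => [|l]; last exact: diff_derivable.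
apply: eq_bigr => l _.
by rewrite (deriveM (diff_derivable (dF l)) (diff_derivable (dJ l))).
Qed.

(** The differential is linear in the direction, and [u] is expanded in the standard basis. Together
    with [derive_graph] this is the chain rule in coordinates. *)
Lemma derive_pairE V m c (f : 'rV[R]_m * V -> 'rV[R]_c) x (u : 'rV[R]_m) w i :
  differentiable f x ->
  'D_(u, w) f x 0 i =
  \sum_l 'D_(delta_mx 0 l, 0) f x 0 i * u 0 l + 'D_(0, w) f x 0 i.
Proof.
move=> df; under eq_bigr do rewrite deriveE//.
rewrite !deriveE//.
have -> : (u, w) = \sum_l u 0 l *: (delta_mx 0 l, 0) + (0, w) :> 'rV_m * V.
  apply: injective_projections => /=.
    rewrite addr0 (raddf_sum fst) /= {1}(matrix_sum_delta u).
    by rewrite big_ord1.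
  rewrite (raddf_sum snd) /= big1 ?add0r// => l _.
  by rewrite scaler0.
rewrite linearD linear_sum /= mxE summxE; congr (_ + _).
by apply: eq_bigr => l _; rewrite linearZ mxE mulrC.
Qed.

Lemma DmxE n c (g : 'rV[R]_n -> 'rV[R]_c) x i j :
  differentiable g x -> Dmx g x i j = 'D_(delta_mx 0 j) g x 0 i.
Proof. by move=> dg; rewrite deriveE// /Dmx /jacobian !mxE. Qed.

Lemma Dmx_coordE n c (g : 'rV[R]_n -> 'rV[R]_c) x i j :
  (forall i, differentiable (fun y => g y 0 i) x) ->
  Dmx g x i j = 'D_(delta_mx 0 j) (fun y => g y 0 i) x.
Proof.
move=> dg; have dg' : differentiable g x.
  by apply/differentiable_mxP => a b; rewrite ord1.
by rewrite DmxE// derive_coord.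
Qed.

Lemma vstackE c n b (B : 'I_c -> 'M[R]_(n, b)) i a j :
  vstack B (mxtens_index (i, a)) j = B i a j.
Proof. by rewrite mxE mxtens_indexK. Qed.

End DirectionalDerivatives.

(** * Action of Kronecker products on stacked blocks *)

Section Kronecker.
Variable R : comPzRingType.

Lemma big_mxtens m n (F : 'I_(m * n) -> R) :
  \sum_r F r = \sum_i \sum_j F (mxtens_index (i, j)).
Proof.
rewrite pair_bigA (reindex (@mxtens_index m n))/=.
  by apply: eq_bigr => -[].
exists (@mxtens_unindex m n) => i _; first exact: mxtens_indexK.
exact: mxtens_unindexK.
Qed.

(** The identity factor on the right keeps the position [a] inside a block, so [A] combines
    corresponding rows of different blocks. *)
Lemma tensmx1_mulE m n c d (A : 'M[R]_(m, d)) (N : 'M[R]_(d * n, c)) i a b :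
  ((A *t 1%:M) *m N) (mxtens_index (i, a)) b =
  \sum_l A i l * N (mxtens_index (l, a)) b.
Proof.
rewrite mxE big_mxtens; apply: eq_bigr => l _.
rewrite (bigD1 a)//= tensmxE mxE eqxx mulr1 big1 ?addr0// => j ja.
by rewrite tensmxE mxE eq_sym (negPf ja) mulr0 mul0r.
Qed.

(** The identity factor on the left keeps the block [i], so [A] acts inside each block
    separately. *)
Lemma tens1mx_mulE m n c d (A : 'M[R]_(n, d)) (N : 'M[R]_(m * d, c)) i a b :
  ((1%:M *t A) *m N) (mxtens_index (i, a)) b =
  \sum_l A a l * N (mxtens_index (i, l)) b.
Proof.
rewrite mxE big_mxtens (bigD1 i)//= [X in _ + X]big1 ?addr0 => [|j ji].
  by apply: eq_bigr => l _; rewrite tensmxE mxE eqxx mul1r.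
apply: big1 => l _.
by rewrite tensmxE mxE eq_sym (negPf ji) !mul0r.
Qed.

End Kronecker.

Lemma invmx_tensmx1_mul (R : comUnitRingType) m n c (A : 'M[R]_m)
    (N : 'M[R]_(m * n, c)) :
  A \in unitmx ->
  (invmx A *t (1%:M : 'M[R]_n)) *m ((A *t (1%:M : 'M[R]_n)) *m N) = N.
Proof.
(* The mixed-product rule leaves the Kronecker product of two identities, which is then seen
   entrywise to act trivially. *)
move=> Au; rewrite mulmxA tensmx_mul mulVmx// mul1mx.
apply/matrixP => r b; case: (mxtens_indexP r) => i a.
rewrite tens1mx_mulE (bigD1 a)//= mxE eqxx mul1r big1 ?addr0// => j ja.
by rewrite mxE eq_sym (negPf ja) mul0r.
Qed.

(** * Second partial derivatives of [k]; first and second derivatives of the implicit function *)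

Section ImplicitHessian.
Variable R : realType.

(** In the applications [G] is the gradient of component [i], and [D a] the derivative of the whole
    vector in direction [a]. They are compared only near [y] because for [zs] the comparison relies
    on differentiability, known near [p]. *)
Lemma Dmx_nearE n b c (G : 'rV[R]_b -> 'rV[R]_n)
    (D : 'I_n -> 'rV[R]_b -> 'rV[R]_c) i y a j :
  (\forall y' \near y, forall a, G y' 0 a = D a y' 0 i) ->
  (forall a, differentiable (D a) y) ->
  Dmx G y a j = 'D_(delta_mx 0 j) (D a) y 0 i.
Proof.
move=> GD dD.
have GDa a' : \forall y' \near y, G y' 0 a' = D a' y' 0 i by exact: filterS GD.
rewrite Dmx_coordE => [|a'].
  by rewrite (near_eq_derive _ (GDa a)) derive_coord.
apply: (near_eq_differentiable (f := fun y' => D a' y' 0 i)).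
  by apply: filterS (GDa a').
by move/differentiable_mxP : (dD a'); apply.
Qed.

Variables (m n : nat) (k : 'rV[R]_m * 'rV[R]_n -> 'rV[R]_m).
Hypothesis dk : forall x, differentiable k x.
Hypothesis ddk : forall v x, differentiable ('D_v k) x.

Let gradlE z q i a :
  grad (fun z' => k (z', q) 0 i) z 0 a = 'D_(delta_mx 0 a, 0) k (z, q) 0 i.
Proof.
rewrite mxE (derive_coord (M := fun z' => k (z', q))) ?derive_slicel//.
exact: differentiable_slicel.
Qed.

Let gradrE z q i a :
  grad (fun q' => k (z, q') 0 i) q 0 a = 'D_(0, delta_mx 0 a) k (z, q) 0 i.
Proof.
rewrite mxE (derive_coord (M := fun q' => k (z, q'))) ?derive_slicer//.
exact: differentiable_slicer.
Qed.

(** Here and in the next three lemmas, the row position [a] carries the inner derivative and the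
    column [j] the outer one, because the gradient is taken first. *)
Lemma Dmixed_lrE z q i a j :
  Dmixed (fun z q => k (z, q)) z q (mxtens_index (i, a)) j =
  'D_(0, delta_mx 0 j) ('D_(delta_mx 0 a, 0) k) (z, q) 0 i.
Proof.
rewrite vstackE (Dmx_nearE (i := i)
  (D := fun a q => 'D_(delta_mx 0 a, 0) k (z, q))).
- by rewrite (derive_slicer ('D_(delta_mx 0 a, 0) k)).
- by apply: (@filterE _ (nbhs _)) => ? ?; rewrite gradlE.
- by move=> a'; exact: (differentiable_slicer (f := 'D_(delta_mx 0 a', 0) k)).
Qed.

Lemma Dmixed_rlE z q i a j :
  Dmixed (fun q z => k (z, q)) q z (mxtens_index (i, a)) j =
  'D_(delta_mx 0 j, 0) ('D_(0, delta_mx 0 a) k) (z, q) 0 i.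
Proof.
rewrite vstackE (Dmx_nearE (i := i)
  (D := fun a z => 'D_(0, delta_mx 0 a) k (z, q))).
- by rewrite (derive_slicel ('D_(0, delta_mx 0 a) k)).
- by apply: (@filterE _ (nbhs _)) => ? ?; rewrite gradrE.
- by move=> a'; exact: (differentiable_slicel (f := 'D_(0, delta_mx 0 a') k)).
Qed.

Lemma Hmx_lE z q i a j :
  Hmx (fun z => k (z, q)) z (mxtens_index (i, a)) j =
  'D_(delta_mx 0 j, 0) ('D_(delta_mx 0 a, 0) k) (z, q) 0 i.
Proof.
rewrite vstackE (Dmx_nearE (i := i)
  (D := fun a z => 'D_(delta_mx 0 a, 0) k (z, q))).
- by rewrite (derive_slicel ('D_(delta_mx 0 a, 0) k)).
- by apply: (@filterE _ (nbhs _)) => ? ?; rewrite gradlE.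
- by move=> a'; exact: (differentiable_slicel (f := 'D_(delta_mx 0 a', 0) k)).
Qed.

Lemma Hmx_rE z q i a j :
  Hmx (fun q => k (z, q)) q (mxtens_index (i, a)) j =
  'D_(0, delta_mx 0 j) ('D_(0, delta_mx 0 a) k) (z, q) 0 i.
Proof.
rewrite vstackE (Dmx_nearE (i := i)
  (D := fun a q => 'D_(0, delta_mx 0 a) k (z, q))).
- by rewrite (derive_slicer ('D_(0, delta_mx 0 a) k)).
- by apply: (@filterE _ (nbhs _)) => ? ?; rewrite gradrE.
- by move=> a'; exact: (differentiable_slicer (f := 'D_(0, delta_mx 0 a') k)).
Qed.

Let Dl (z : 'rV[R]_m) q := Dmx (fun z' => k (z', q)) z.
Let Dr (z : 'rV[R]_m) q := Dmx (fun q' => k (z, q')) q.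

Let DlE z q i l : Dl z q i l = 'D_(delta_mx 0 l, 0) k (z, q) 0 i.
Proof. by rewrite /Dl DmxE ?derive_slicel//; exact: differentiable_slicel. Qed.

Let DrE z q i a : Dr z q i a = 'D_(0, delta_mx 0 a) k (z, q) 0 i.
Proof. by rewrite /Dr DmxE ?derive_slicer//; exact: differentiable_slicer. Qed.

Variable zs : 'rV[R]_n -> 'rV[R]_m.
Hypothesis zs_continuous : continuous zs.
Hypothesis k_zs : forall p, k (zs p, p) = 0.

Lemma differentiable_implicit p :
  Dl (zs p) p \in unitmx -> differentiable zs p.
Proof.
move=> Au.
(* Points are row vectors, so the partial differential in z is right multiplication by the
   transposed Jacobian, and [L] inverts it. *)
pose L : {linear 'rV[R]_m -> 'rV[R]_m} := mulmxr (invmx (Dl (zs p) p)^T).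
apply: (implicit_differentiable (k := k) (L := L)) => //.
- exact: zs_continuous.
- by move=> q; rewrite !k_zs.
- move=> x; apply: differentiable_continuous.
  apply: (@differentiable_mulmx _ _ _ _ _ id (cst _));
    last exact: differentiable_cst.
  exact: ex_diff.
- move=> u; have -> : 'd k (zs p, p) (u, 0) = u *m (Dl (zs p) p)^T.
    apply/rowP => i; rewrite -deriveE// derive_pairE// derive0 !mxE addr0.
    by apply: eq_bigr => l _; rewrite mxE DlE mulrC.
  by rewrite /= -mulmxA mulmxV ?mulmx1// unitmx_tr.
Qed.

Lemma differentiable_graphDl p :
  differentiable zs p -> differentiable (fun q => Dl (zs q) q) p.
Proof.
move=> dz; apply/differentiable_mxP => i l; under eq_fun do rewrite DlE.
have : differentiable (fun q => 'D_(delta_mx 0 l, 0) k (zs q, q)) p.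
  exact: (differentiable_graph (f := 'D_(delta_mx 0 l, 0) k)).
by move/differentiable_mxP; apply.
Qed.

Lemma differentiable_graphDr p :
  differentiable zs p -> differentiable (fun q => Dr (zs q) q) p.
Proof.
move=> dz; apply/differentiable_mxP => i l; under eq_fun do rewrite DrE.
have : differentiable (fun q => 'D_(0, delta_mx 0 l) k (zs q, q)) p.
  exact: (differentiable_graph (f := 'D_(0, delta_mx 0 l) k)).
by move/differentiable_mxP; apply.
Qed.

(** The left-hand side is, by the chain rule, a derivative of [q |-> k (zs q, q)], which vanishes
    identically. *)
Lemma implicit_DmxE p i a : differentiable zs p ->
  \sum_l Dl (zs p) p i l * Dmx zs p l a + Dr (zs p) p i a = 0.
Proof.
move=> dz; transitivity ('D_(delta_mx 0 a) (fun q => k (zs q, q)) p 0 i).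
  have -> := derive_graph (f := k) (z := zs) (delta_mx 0 a) dz (dk _).
  rewrite [RHS](derive_pairE _ _ _ (dk _)).
  apply: congr2; last exact: DrE.
  by apply: eq_bigr => l _; apply: congr2; [exact: DlE|exact: DmxE].
by under eq_fun do rewrite k_zs; rewrite derive_cst mxE.
Qed.

Lemma near_implicit_differentiable p : Dl (zs p) p \in unitmx ->
  (\forall q \near p, differentiable zs q) /\ differentiable (Dmx zs) p.
Proof.
move=> Au; have dz := differentiable_implicit Au.
have [nu dinv] := differentiable_invmx (differentiable_graphDl dz) Au.
split; first by apply: filterS nu; exact: differentiable_implicit.
(* Wherever D_z k is invertible near [p], the first-order identity is solved for Dz; the resulting
   closed form is differentiable at [p]. *)
apply: (near_eq_differentiable
  (f := fun q => invmx (Dl (zs q) q) *m (- Dr (zs q) q))).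
  apply: filterS nu => q Aq.
  rewrite -[RHS](mulKmx Aq); congr (_ *m _); apply/matrixP => i a.
  rewrite [LHS]mxE [RHS]mxE; apply/esym/eqP; rewrite -addr_eq0; apply/eqP.
  exact/implicit_DmxE/differentiable_implicit.
apply: differentiable_mulmx => //.
by apply: differentiableN; exact: differentiable_graphDr.
Qed.

Lemma implicit_Hmx p :
  (\forall q \near p, differentiable zs q) -> differentiable (Dmx zs) p ->
  Hmx (fun q => k (zs p, q)) p
  + Dmixed (fun q z => k (z, q)) p (zs p) *m Dmx zs p
  + (1%:M *t (Dmx zs p)^T) *m Dmixed (fun z q => k (z, q)) (zs p) p
  + (1%:M *t (Dmx zs p)^T) *m Hmx (fun z => k (z, p)) (zs p) *m Dmx zs p
  = - ((Dl (zs p) p *t 1%:M) *m Hmx zs p).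
Proof.
move=> ndz dJ; have dz := nbhs_singleton ndz.
have dDa a : differentiable ('D_(delta_mx 0 a) zs) p.
  apply/differentiable_mxP => i0 l; rewrite ord1.
  apply: (near_eq_differentiable (f := fun q => Dmx zs q l a)).
    by apply: filterS ndz => q dq; rewrite DmxE.
  by move/differentiable_mxP : dJ; apply.
have dJla l a : differentiable (fun q => Dmx zs q l a) p.
  by move/differentiable_mxP : dJ; apply.
have dDl i l : differentiable (fun q => Dl (zs q) q i l) p.
  by move/differentiable_mxP : (differentiable_graphDl dz); apply.
have dDr i a : differentiable (fun q => Dr (zs q) q i a) p.
  by move/differentiable_mxP : (differentiable_graphDr dz); apply.
(* Near [p] the gradients of the components of [zs] are the rows of [Dmx zs], so the Hessian entries
   are derivatives of Jacobian entries. *)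
have HzE l a b : Hmx zs p (mxtens_index (l, a)) b =
    'D_(delta_mx 0 b) (fun q => Dmx zs q l a) p.
  rewrite vstackE (Dmx_nearE (D := fun a => 'D_(delta_mx 0 a) zs) (i := l))//.
    rewrite -derive_coord//; apply: near_eq_derive.
    by apply: filterS ndz => q dq; rewrite DmxE.
  by apply: filterS ndz => q dq a'; rewrite mxE derive_coord.
(* Chain rule along the graph for a first derivative of [k]; it is used with [v] a basis vector of
   either factor. *)
have DDE v b i : 'D_(delta_mx 0 b) (fun q => 'D_v k (zs q, q) 0 i) p =
    \sum_l 'D_(delta_mx 0 l, 0) ('D_v k) (zs p, p) 0 i * Dmx zs p l b
    + 'D_(0, delta_mx 0 b) ('D_v k) (zs p, p) 0 i.
  rewrite (derive_coord (M := fun q => 'D_v k (zs q, q))); last first.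
    exact: (differentiable_graph (f := 'D_v k)).
  have -> := derive_graph (f := 'D_v k) (z := zs) (delta_mx 0 b) dz (ddk v _).
  rewrite [LHS](derive_pairE _ _ _ (ddk v _)).
  apply: congr2 => //; apply: eq_bigr => l _; apply: congr2 => //.
  exact/esym/DmxE.
have DlqE i l : (fun q => Dl (zs q) q i l) =
    (fun q => 'D_(delta_mx 0 l, 0) k (zs q, q) 0 i).
  by apply/funext => q; exact: DlE.
have DrqE i a : (fun q => Dr (zs q) q i a) =
    (fun q => 'D_(0, delta_mx 0 a) k (zs q, q) 0 i).
  by apply/funext => q; exact: DrE.
apply/matrixP => r b; case: (mxtens_indexP r) => i a.
pose J := Dmx zs p; pose A := Dl (zs p) p.
pose DD v w := 'D_w ('D_v k) (zs p, p) 0 i.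
(* The first sum is the product rule for (D_z k) Dz, the last two terms come from D_p k. The total
   is 0 because the first-order identity holds on a neighbourhood of [p]. *)
have key : \sum_l (A i l * Hmx zs p (mxtens_index (l, a)) b +
      J l a * (\sum_l' DD (delta_mx 0 l, 0) (delta_mx 0 l', 0) * J l' b +
               DD (delta_mx 0 l, 0) (0, delta_mx 0 b))) +
    (\sum_l DD (0, delta_mx 0 a) (delta_mx 0 l, 0) * J l b +
     DD (0, delta_mx 0 a) (0, delta_mx 0 b)) = 0.
  transitivity ('D_(delta_mx 0 b)
    (fun q => \sum_l Dl (zs q) q i l * Dmx zs q l a + Dr (zs q) q i a) p).
    apply/esym/(etrans (derive_sum_mulD (F := fun l q => Dl (zs q) q i l)
      (J := fun l q => Dmx zs q l a) (G := fun q => Dr (zs q) q i a)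
      (delta_mx 0 b) (dDl i) (dJla^~ a) (dDr i a))).
    apply: congr2; last by rewrite DrqE DDE.
    apply: eq_bigr => l _; apply: congr2.
      by apply: congr2; [|exact/esym/HzE].
    by apply: congr2 => //; rewrite DlqE DDE.
  rewrite -[RHS](derive_cst (0 : R) p (delta_mx 0 b)); apply: near_eq_derive.
  by apply: filterS ndz => q dq; exact: implicit_DmxE.
have addE (M N : 'M[R]_(m * n, n)) r' : (M + N) r' b = M r' b + N r' b.
  by rewrite mxE.
(* The four summands are, in order, the entries of the four terms of the bracket; the transposed
   Jacobian contributes the factors [J l a]. *)
transitivity (DD (0, delta_mx 0 a) (0, delta_mx 0 b)
  + \sum_l DD (0, delta_mx 0 a) (delta_mx 0 l, 0) * J l b
  + \sum_l J l a * DD (delta_mx 0 l, 0) (0, delta_mx 0 b)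
  + \sum_l J l a * \sum_l' DD (delta_mx 0 l, 0) (delta_mx 0 l', 0) * J l' b).
  rewrite !addE; apply: congr2; [apply: congr2; [apply: congr2|]|].
  - exact: Hmx_rE.
  - rewrite mxE; apply: eq_bigr => l _; apply: congr2 => //; exact: Dmixed_rlE.
  - rewrite tens1mx_mulE; apply: eq_bigr => l _; apply: congr2.
      by rewrite [LHS]mxE.
    exact: Dmixed_lrE.
  - rewrite -mulmxA tens1mx_mulE; apply: eq_bigr => l _; apply: congr2.
      by rewrite [LHS]mxE.
    rewrite mxE; apply: eq_bigr => l' _; apply: congr2 => //; exact: Hmx_lE.
(* Once [key] is distributed, both sides are linear in the same sums, which [lra] treats as
   atoms. *)
rewrite [RHS]mxE tensmx1_mulE; move: key.
under eq_bigr do rewrite mulrDr.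
rewrite !big_split /= -/A.
move: (\sum_l A i l * _) => S1; lra.
Qed.

End ImplicitHessian.

Theorem theorem2 (R : realType) (m n : nat)
  (k : 'rV[R]_m * 'rV[R]_n -> 'rV[R]_m) (zs : 'rV[R]_n -> 'rV[R]_m)
  (k_C2 : C2 k)
  (zs_continuous : continuous zs)
  (k_zs : forall p : 'rV[R]_n, k (zs p, p) = 0)
  (p : 'rV[R]_n)
  (Dzk_unit : Dmx (fun z => k (z, p)) (zs p) \in unitmx) :
  (\forall q \near p, differentiable zs q) /\
  differentiable (Dmx zs) p /\
  let Dzs  := Dmx zs p in
  let Dzk  := Dmx (fun z => k (z, p)) (zs p) in
  let Dpzk := Dmixed (fun q z => k (z, q)) p (zs p) in
  let Dzpk := Dmixed (fun z q => k (z, q)) (zs p) p in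
  let Hzk  := Hmx (fun z => k (z, p)) (zs p) in
  let Hpk  := Hmx (fun q => k (zs p, q)) p in
  Hmx zs p =
  - (invmx Dzk *t (1%:M : 'M[R]_n)) *m
    (Hpk + Dpzk *m Dzs
     + ((1%:M : 'M[R]_m) *t Dzs^T) *m Dzpk
     + ((1%:M : 'M[R]_m) *t Dzs^T) *m Hzk *m Dzs).
Proof.
case: k_C2 => -[dk _] C1k.
have ddk v x : differentiable ('D_v k) x by case: (C1k v).
have [ndz dJ] :=
  near_implicit_differentiable dk ddk zs_continuous k_zs Dzk_unit.
split=> //; split=> // Dzs Dzk Dpzk Dzpk Hzk Hpk.
(* The bracket becomes minus the product of D_z k ⊗ I with the Hessian; the signs cancel and the
   inverse factor removes D_z k ⊗ I. *)
rewrite (implicit_Hmx dk ddk k_zs ndz dJ).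
by rewrite mulNmx mulmxN opprK invmx_tensmx1_mul.
Qed.
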